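(* Let $P$ be a finite poset on two or more points and let $x$ be an element of $P$. Then $\operatorname{ldim}(P)\le 1+\operatorname{ldim}(P-\{x\})$.
   Context: $P-\{x\}$ is the subposet of $P$ on the remaining points. A partial linear extension (ple) of a poset $P$ is a linear extension of a subposet of $P$. For a family $\mathcal{L}$ of ple's, $\mu(u,\mathcal{L})$ is the number of members containing $u$ and $\mu(\mathcal{L})=\max_u\mu(u,\mathcal{L})$. A non-empty family $\mathcal{L}$ is a local realizer of $P$ if (1) whenever $x\le y$ in $P$ some $L\in\mathcal{L}$ has $x\le y$ in $L$, and (2) whenever $x\parallel y$ in $P$ some $L\in\mathcal{L}$ has $x>y$ in $L$. $\operatorname{ldim}(P)$ is the minimum of $\mu(\mathcal{L})$ over local realizers $\mathcal{L}$ of $P$. *)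

(* Defs.v *)
From HB Require Import structures.
From mathcomp Require Import all_boot all_order.

Set Implicit Arguments.
Unset Strict Implicit.
Unset Printing Implicit Defensive.

Import Order.TTheory.
Local Open Scope order_scope.

Section LocalDimension.
Variables (d : Order.disp_t) (T : finPOrderType d).
Implicit Types (A : {set T}) (L : {set T * T}) (F : {set {set T * T}}).

(* Orders are sets of pairs: (x, y) \in L reads "x <= y in L". Totality is
   required for x = y too, so it includes reflexivity on A. *)
Definition linear_order_on A L : bool :=
  [&& L \subset setX A A,
      [forall x in A, forall y in A, ((x, y) \in L) || ((y, x) \in L)],
      [forall x, forall y, ((x, y) \in L) && ((y, x) \in L) ==> (x == y)] &
      [forall x, forall y, forall z,
         ((x, y) \in L) && ((y, z) \in L) ==> ((x, z) \in L)]].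

Definition linear_extension A L : bool :=
  linear_order_on A L &&
  [forall x in A, forall y in A, (x <= y) ==> ((x, y) \in L)].

(* The ground set A is determined by L: u \in A iff (u, u) \in L. *)
Definition ple L : bool := [exists A, linear_extension A L].

Definition ple_ground L : {set T} := [set u | (u, u) \in L].

Lemma linear_extension_ground A L : linear_extension A L -> ple_ground L = A.
Proof.
case/andP=> /and4P[/subsetP LA /forall_inP tot _ _] _.
apply/setP=> u; rewrite inE; apply/idP/idP=> [/LA|uA].
  by rewrite inE /= andbb.
by have /forall_inP/(_ u uA) := tot u uA; rewrite orbb.
Qed.

Definition local_realizer F : bool :=
  [&& F != set0,
      [forall L in F, ple L],
      [forall x, forall y, (x <= y) ==> [exists L in F, (x, y) \in L]] &
      [forall x, forall y, (x >< y) ==> [exists L in F, (y, x) \in L]]].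

Definition mult F (u : T) : nat := #|[set L in F | u \in ple_ground L]|.

Definition max_mult F : nat := (\max_(u : T) mult F u)%N.

Lemma ple_pair (a b : T) :
  ~~ (b < a) -> ple [set (a, a); (a, b); (b, b)].
Proof.
move=> ba; apply/existsP; exists [set a; b]; apply/andP; split.
  apply/and4P; split.
  - apply/subsetP=> -[x y]; rewrite !inE /= !xpair_eqE.
    by case/orP=> [/orP[]|] /andP[-> ->]; rewrite ?orbT.
  - apply/forall_inP=> x xA; apply/forall_inP=> y yA.
    move: xA yA; rewrite !inE !xpair_eqE.
    by case/orP=> /eqP->; case/orP=> /eqP->; rewrite !eqxx ?orbT.
  - apply/forallP=> x; apply/forallP=> y; apply/implyP.
    rewrite !inE !xpair_eqE.
    case/andP=> /orP[/orP[]|] /andP[/eqP-> /eqP->] //.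
    by rewrite orbC => /orP[/andP[_ /eqP->]|/orP[]/andP[/eqP->]].
  - apply/forallP=> x; apply/forallP=> y; apply/forallP=> z; apply/implyP.
    rewrite !inE !xpair_eqE => /andP[].
    case/orP=> [/orP[]|] /andP[/eqP-> /eqP->];
    by case/orP=> [/orP[]|] /andP[h /eqP->]; rewrite ?eqxx ?h ?orbT.
apply/forall_inP=> x xA; apply/forall_inP=> y yA; apply/implyP.
move: xA yA; rewrite !inE !xpair_eqE.
case/orP=> /eqP->; case/orP=> /eqP->; rewrite ?eqxx ?orbT //.
by rewrite le_eqVlt (negPf ba) orbF => /eqP->; rewrite eqxx.
Qed.

Lemma ple0 : ple set0.
Proof.
apply/existsP; exists set0; apply/andP; split; last first.
  by apply/forall_inP=> x; rewrite inE.
apply/and4P; split; first exact: sub0set.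
- by apply/forall_inP=> x; rewrite inE.
- by apply/forallP=> x; apply/forallP=> y; rewrite !inE.
- by apply/forallP=> x; apply/forallP=> y; apply/forallP=> z; rewrite !inE.
Qed.

Lemma local_realizer_all : local_realizer [set L | ple L].
Proof.
apply/and4P; split.
- by apply/set0Pn; exists set0; rewrite inE ple0.
- by apply/forall_inP=> L; rewrite inE.
- apply/forallP=> x; apply/forallP=> y; apply/implyP=> xy.
  apply/exists_inP; exists [set (x, x); (x, y); (y, y)].
    by rewrite inE ple_pair // le_gtF.
  by rewrite !inE eqxx orbT.
apply/forallP=> x; apply/forallP=> y; apply/implyP=> xy.
apply/exists_inP; exists [set (y, y); (y, x); (x, x)].
  by rewrite inE ple_pair // incomparable_ltF.
by rewrite !inE eqxx orbT.
Qed.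

Lemma ex_local_realizer :
  exists n, [exists F, local_realizer F && (max_mult F == n)].
Proof.
exists (max_mult [set L | ple L]); apply/existsP.
by exists [set L | ple L]; rewrite local_realizer_all eqxx.
Qed.

Definition ldim : nat := ex_minn ex_local_realizer.

End LocalDimension.

Arguments ldim {d} T.

Section Deletion.
Variables (d : Order.disp_t) (T : finPOrderType d) (x : T).

Record subposet_del := SubposetDel { del_val : T; _ : del_val != x }.

HB.instance Definition _ := [isSub for del_val].
HB.instance Definition _ := [Finite of subposet_del by <:].
HB.instance Definition _ := [SubChoice_isSubPOrder of subposet_del by <: with d].

Lemma le_subposet_del (u v : subposet_del) : (u <= v) = (val u <= val v).
Proof. by []. Qed.

End Deletion.

(* Main.v *)
(** Let [F] be an optimal local realizer of [P - {x}], let [y] be any point of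
    [P - {x}], and call the members of [F] containing [y] the star of [y].
    Every point shares a member of [F] with [y], so the star covers [P - {x}].
    Fix [L0] in the star and insert [x] into each other member [L] of the star,
    at its place in a linear extension of [P] that extends [L].  As in
    Hiraguchi's argument, replace [L0] by two copies [lowx] and [highx]: the
    first puts [x] right above its down-set, the second right below its up-set,
    and together they keep all relations of [L0].  A point [z] outside [L0]
    lies with [x] in another member of the star; it is added to [lowx] only if
    it is below [x] in such a member, and to [highx] only otherwise.  Hence
    every point occurs at most once more than before, and [x] occurs twice plus
    the number of members of the star other than [L0]. *)
Require Import Defs.
From mathcomp Require Import all_boot all_order.

Set Implicit Arguments.
Unset Strict Implicit.
Unset Printing Implicit Defensive.

Import Order.TTheory.
Local Open Scope order_scope.

(** * Lexicographic combination of two rank functions *)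

Section Lexicographic.
Variables (T : finType) (p f : T -> nat).

(** The multiplier exceeds every value of [f], so [p] decides first and [f] only breaks ties. *)
Definition lex_rank (z : T) : nat := p z * (\max_t f t).+1 + f z.

Lemma leq_lex_rank u v :
  (lex_rank u <= lex_rank v)%N =
  (p u < p v)%N || (p u == p v) && (f u <= f v)%N.
Proof.
rewrite /lex_rank; set N := (\max_t f t).+1.
have fN t : (f t < N)%N by rewrite ltnS leq_bigmax.
have key a b : (p a < p b)%N -> (p a * N + f a < p b * N + f b)%N.
  move=> ab; rewrite (@leq_trans ((p a).+1 * N)) //.
    by rewrite mulSn [(N + _)%N]addnC ltn_add2l.
  by rewrite (leq_trans _ (leq_addr _ _)) // leq_mul2r ab orbT.
case: (ltngtP (p u) (p v)) => [/key/ltnW->//|/key vu|->] /=.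
  by apply/negbTE; rewrite -ltnNge.
by rewrite leq_add2l.
Qed.

Lemma lex_rank_inj : injective f -> injective lex_rank.
Proof.
move=> f_inj u v uv; apply: f_inj.
have := leq_lex_rank u v; have := leq_lex_rank v u.
rewrite uv leqnn; case: ltngtP => //= _ /esym vu /esym uv'.
by apply/eqP; rewrite eqn_leq uv' vu.
Qed.

End Lexicographic.

(** * Linear extensions encoded by ranks *)

Section RankedPle.
Variables (d : Order.disp_t) (T : finPOrderType d).
Implicit Types (A : {set T}) (f : T -> nat).

(** Such a rank encodes a linear extension of all of [T]; restricting it to any ground set gives a
    ple. *)
Definition lin_ext_rank f : Prop :=
  injective f /\ forall u v, u <= v -> (f u <= f v)%N.

Definition ranked_ple A f : {set T * T} :=
  [set w | [&& w.1 \in A, w.2 \in A & (f w.1 <= f w.2)%N]].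

Lemma ranked_pleE A f u v :
  ((u, v) \in ranked_ple A f) = [&& u \in A, v \in A & (f u <= f v)%N].
Proof. by rewrite inE. Qed.

Lemma ple_ground_ranked A f : ple_ground (ranked_ple A f) = A.
Proof. by apply/setP=> u; rewrite !inE leqnn andbT andbb. Qed.

Lemma ranked_ple_ple A f : lin_ext_rank f -> ple (ranked_ple A f).
Proof.
move=> [f_inj f_mon]; apply/existsP; exists A; apply/andP; split; last first.
  apply/forall_inP=> u uA; apply/forall_inP=> v vA; apply/implyP=> uv.
  by rewrite ranked_pleE uA vA f_mon.
apply/and4P; split.
- by apply/subsetP=> -[u v]; rewrite ranked_pleE inE /= => /and3P[-> ->].
- apply/forall_inP=> u uA; apply/forall_inP=> v vA.
  by rewrite !ranked_pleE uA vA /= leq_total.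
- apply/forallP=> u; apply/forallP=> v; apply/implyP; rewrite !ranked_pleE.
  case/andP=> /and3P[_ _ uv] /and3P[_ _ vu]; apply/eqP/f_inj/eqP.
  by rewrite eqn_leq uv.
- apply/forallP=> u; apply/forallP=> v; apply/forallP=> w; apply/implyP.
  rewrite !ranked_pleE => /andP[/and3P[-> _ uv] /and3P[_ -> vw]] /=.
  exact: leq_trans uv vw.
Qed.

Lemma lin_ext_rank_lex (p f : T -> nat) :
  (forall u v, u <= v -> (p u <= p v)%N) -> lin_ext_rank f ->
  lin_ext_rank (lex_rank p f).
Proof.
move=> p_mon [f_inj f_mon]; split; first exact: lex_rank_inj.
by move=> u v uv; rewrite leq_lex_rank f_mon // andbT orbC -leq_eqVlt p_mon.
Qed.

(** Down-sets grow strictly along [<], and [enum_rank] separates points whose down-sets have equal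
    size. *)
Definition height_rank : T -> nat :=
  lex_rank (fun z : T => #|[set t | t <= z]|)
           (fun z : T => enum_rank z : nat).

Lemma height_rankP : lin_ext_rank height_rank.
Proof.
split; first by apply: lex_rank_inj => u v /val_inj/enum_rank_inj.
move=> u v; rewrite le_eqVlt => /predU1P[->//|uv].
rewrite leq_lex_rank proper_card //; apply/properP; split.
  by apply/subsetP=> t; rewrite !inE => /le_trans; apply; apply: ltW.
by exists v; rewrite !inE ?lexx // lt_geF.
Qed.

End RankedPle.

(** * Order properties and positions inside one ple *)

Section PleTheory.
Variables (d : Order.disp_t) (T : finPOrderType d) (L : {set T * T}).
Hypothesis pleL : ple L.

Lemma ple_ext : linear_extension (ple_ground L) L.
Proof.
by case/existsP: (pleL) => A LA; rewrite (linear_extension_ground LA).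
Qed.

Lemma ple_groundW u v :
  (u, v) \in L -> u \in ple_ground L /\ v \in ple_ground L.
Proof.
case/andP: ple_ext => /and4P[/subsetP LA _ _ _] _ /LA.
by rewrite in_setX => /andP.
Qed.

Lemma ple_anti u v : (u, v) \in L -> (v, u) \in L -> u = v.
Proof.
case/andP: ple_ext => /and4P[_ _ /forallP/(_ u)/forallP/(_ v)/implyP LA _] _.
by move=> uv vu; apply/eqP/LA; rewrite uv.
Qed.

Lemma ple_trans u v w : (u, v) \in L -> (v, w) \in L -> (u, w) \in L.
Proof.
case/andP: ple_ext => /and4P[_ _ _ /forallP/(_ u)/forallP/(_ v)] + _.
by move=> /forallP/(_ w)/implyP LA uv vw; apply: LA; rewrite uv.
Qed.

Lemma ple_le u v :
  u \in ple_ground L -> v \in ple_ground L -> u <= v -> (u, v) \in L.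
Proof.
by case/andP: ple_ext => _ /forall_inP/[swap] uA /(_ u uA)/forall_inP/[swap]
  vA /(_ v vA)/implyP.
Qed.

Definition ple_rank (u : T) : nat := #|[set t | (t, u) \in L]|.

Lemma leq_ple_rank u v : (u, v) \in L -> (ple_rank u <= ple_rank v)%N.
Proof.
move=> uv; apply/subset_leq_card/subsetP=> t; rewrite !inE => tu.
exact: ple_trans tu uv.
Qed.

Lemma ltn_ple_rank u v :
  (u, v) \in L -> u != v -> (ple_rank u < ple_rank v)%N.
Proof.
move=> uv neq_uv; apply/proper_card/properP; split.
  by apply/subsetP=> t; rewrite !inE => tu; apply: ple_trans tu uv.
have [_ vL] := ple_groundW uv; exists v; first by rewrite !inE in vL *.
by rewrite inE; apply: contra neq_uv => /(ple_anti uv)->.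
Qed.

End PleTheory.

(** * Extending a ple of the subposet to the whole poset *)

Section Extend.
Variables (d : Order.disp_t) (T : finPOrderType d) (x : T).
Local Notation Q := (subposet_del x).
Implicit Types (a b : Q) (L : {set Q * Q}).

(* Ranking [z] first by the largest rank in [L] of a point of [L] below [z]
   makes the order on all of [T] extend both [L] and the order of [T]. *)
Definition ext_key L (z : T) : nat :=
  \max_(a in ple_ground L | val a <= z) ple_rank L a.

Definition ext_rank L : T -> nat := lex_rank (ext_key L) (@height_rank d T).

Lemma ext_rankP L : lin_ext_rank (ext_rank L).
Proof.
apply: lin_ext_rank_lex (height_rankP T) => u v uv.
apply/bigmax_leqP=> a /andP[aL au].
by apply: (@leq_bigmax_cond _ _ (ple_rank L)); rewrite aL (le_trans au uv).
Qed.

(** The maximum is attained at [a] itself: any point of [L] below [a] in the poset also precedes it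
    in [L]. *)
Lemma ext_key_val L a :
  ple L -> a \in ple_ground L -> ext_key L (val a) = ple_rank L a.
Proof.
move=> pleL aL; apply/eqP; rewrite eqn_leq; apply/andP; split.
  by apply/bigmax_leqP=> b /andP[bL ba]; apply/leq_ple_rank/ple_le.
by apply: (@leq_bigmax_cond _ _ (ple_rank L)); rewrite aL lexx.
Qed.

Lemma ext_rank_le L a b :
  ple L -> (a, b) \in L -> (ext_rank L (val a) <= ext_rank L (val b))%N.
Proof.
move=> pleL ab; have [aL bL] := ple_groundW pleL ab.
have [->//|neq_ab] := eqVneq a b.
(* Distinct points of [L] have distinct keys, so [height_rank] is never consulted. *)
by rewrite leq_lex_rank !ext_key_val // ltn_ple_rank.
Qed.

End Extend.

(** * The new local realizer *)

Section Removal.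
Variables (d : Order.disp_t) (T : finPOrderType d) (x : T).
Local Notation Q := (subposet_del x).
Variables (F : {set {set Q * Q}}) (y : Q) (L0 : {set Q * Q}).
Hypotheses (realF : local_realizer F) (L0F : L0 \in F).
Hypothesis yL0 : y \in ple_ground L0.
Implicit Types (a b c : Q) (L : {set Q * Q}) (z : T).

Let Fple L : L \in F -> ple L.
Proof. by case/and4P: realF => _ /forall_inP + _ _; apply. Qed.

Definition lift_ground L : {set T} := val @: ple_ground L.

Lemma mem_lift_ground L a : (val a \in lift_ground L) = (a \in ple_ground L).
Proof. by rewrite mem_imset //; apply: val_inj. Qed.

Lemma x_lift_ground L : (x \in lift_ground L) = false.
Proof. by apply/negP=> /imsetP[[a ax] _ /= xa]; rewrite -xa eqxx in ax. Qed.

Definition ins_ground L : {set T} :=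
  [set z | (z \in lift_ground L) || (y \in ple_ground L) && (z == x)].

Definition ins L : {set T * T} := ranked_ple (ins_ground L) (ext_rank L).

Definition belowx z : bool :=
  [exists L in F :\ L0, [&& y \in ple_ground L, z \in lift_ground L &
                            (ext_rank L z < ext_rank L x)%N]].

Definition low_ground : {set T} :=
  [set z | [|| z == x, z \in lift_ground L0 | belowx z]].
Definition high_ground : {set T} :=
  [set z | [|| z == x, z \in lift_ground L0 | ~~ belowx z]].

(** The leading digit is 0 exactly on the down-set of [x], and [x] has the largest [ext_rank] there,
    so it ends this block. *)
Definition low_rank : T -> nat :=
  lex_rank (fun z => nat_of_bool (~~ (z <= x))) (ext_rank L0).
(** Dually, the digit 1 marks the up-set of [x], and [x] starts this block. *)
Definition high_rank : T -> nat :=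
  lex_rank (fun z => nat_of_bool (x <= z)) (ext_rank L0).

Definition lowx : {set T * T} := ranked_ple low_ground low_rank.
Definition highx : {set T * T} := ranked_ple high_ground high_rank.

Definition removal_realizer : {set {set T * T}} :=
  lowx |: (highx |: ins @: (F :\ L0)).
Local Notation F' := removal_realizer.

Lemma low_rankP : lin_ext_rank low_rank.
Proof.
apply: lin_ext_rank_lex (ext_rankP L0) => u v uv.
by case: (boolP (u <= x)) => //= ux; rewrite (contra (le_trans uv) ux).
Qed.

Lemma high_rankP : lin_ext_rank high_rank.
Proof.
apply: lin_ext_rank_lex (ext_rankP L0) => u v uv.
by case: (boolP (x <= u)) => [/le_trans->|].
Qed.

Lemma lowxF : lowx \in F'. Proof. by rewrite !inE eqxx. Qed.
Lemma highxF : highx \in F'. Proof. by rewrite !inE eqxx orbT. Qed.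
Lemma insF L : L \in F -> L != L0 -> ins L \in F'.
Proof.
by move=> LF LL0; rewrite !inE imset_f ?orbT // !inE LL0.
Qed.

Lemma removal_ple N : N \in F' -> ple N.
Proof.
rewrite !inE => /or3P[/eqP->|/eqP->|/imsetP[L _ ->]]; apply: ranked_ple_ple.
- exact: low_rankP.
- exact: high_rankP.
- exact: ext_rankP.
Qed.

Lemma removal_keeps L a b : L \in F -> (a, b) \in L ->
  exists2 N, N \in F' & (val a, val b) \in N.
Proof.
move=> LF ab; have [aL bL] := ple_groundW (Fple LF) ab.
have fab := ext_rank_le (Fple LF) ab.
have [eqL|neqL] := eqVneq L L0; last first.
  exists (ins L); first exact: insF.
  by rewrite ranked_pleE !inE !mem_lift_ground aL bL.
(* The digits of [low_rank] reverse [(a, b)] only when [b] is below [x] and [a] is not; [highx]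
   serves that case. *)
subst L; case: (boolP ((val b <= x) && ~~ (val a <= x))) => [/andP[bx ax]|lo].
  exists highx; first exact: highxF.
  rewrite ranked_pleE !inE !mem_lift_ground aL bL !orbT /=.
  rewrite leq_lex_rank fab andbT orbC -leq_eqVlt.
  case: (boolP (x <= val a)) => // xa.
  (* Now [b <= x <= a] would put [(b, a)] in [L0] beside [(a, b)], forcing [a = b] against [ax]. *)
  have ba : b <= a by rewrite le_subposet_del (le_trans bx xa).
  have eab : a = b.
    by apply: (ple_anti (Fple LF) ab); apply: ple_le => //; exact: Fple.
  by rewrite eab bx in ax.
exists lowx; first exact: lowxF.
rewrite ranked_pleE !inE !mem_lift_ground aL bL !orbT /=.
rewrite leq_lex_rank fab andbT orbC -leq_eqVlt.
by move: lo; rewrite negb_and negbK; case: (val b <= x); case: (val a <= x).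
Qed.

(** Comparable or not, [y] and [c] fall under a realizer condition, and the member that witnesses it
    contains both. *)
Lemma star_cover c :
  exists2 L, L \in F & (y \in ple_ground L) && (c \in ple_ground L).
Proof.
case/and4P: realF => _ _ /forallP leF /forallP incF.
have [yc|yc] := boolP (y >=< c); last first.
  have /forallP/(_ c)/implyP/(_ yc)/exists_inP[L LF] := incF y.
  by move=> /(ple_groundW (Fple LF))[cL yL]; exists L; rewrite ?yL.
case/orP: yc => [yc|cy].
  have /forallP/(_ c)/implyP/(_ yc)/exists_inP[L LF] := leF y.
  by move=> /(ple_groundW (Fple LF))[cL yL]; exists L; rewrite ?cL.
have /forallP/(_ y)/implyP/(_ cy)/exists_inP[L LF] := leF c.
by move=> /(ple_groundW (Fple LF))[cL yL]; exists L; rewrite ?yL.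
Qed.

Lemma removal_below z : ~~ (x <= z) ->
  exists2 N, N \in F' & (z, x) \in N.
Proof.
move=> xz; case: (boolP (z \in high_ground)) => [zg|].
  exists highx; first exact: highxF.
  rewrite ranked_pleE zg !inE eqxx /=.
  by rewrite leq_lex_rank lexx (negPf xz).
(* A point missing from [highx] satisfies [belowx], so a star member other than [L0] ranks it under
   [x]. *)
rewrite !inE !negb_or negbK => /and3P[_ _ /exists_inP[L]].
rewrite !inE => /andP[LL0 LF] /and3P[yL zL zx].
exists (ins L); first exact: insF.
by rewrite ranked_pleE !inE zL yL eqxx orbT ltnW.
Qed.

Lemma removal_above z : ~~ (z <= x) ->
  exists2 N, N \in F' & (x, z) \in N.
Proof.
move=> zx; case: (boolP (z \in low_ground)) => [zg|].
  exists lowx; first exact: lowxF.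
  rewrite ranked_pleE zg !inE eqxx /=.
  by rewrite leq_lex_rank lexx (negPf zx).
rewrite !inE !negb_or => /and3P[zneqx zL0 /exists_inPn zbelow].
pose c : Q := SubposetDel zneqx.
(* As [z] is outside [L0], this star member is not [L0]; since [belowx z] fails, it ranks [x] under
   [z]. *)
have [L LF /andP[yL]] := star_cover c.
rewrite -mem_lift_ground /= => cL.
have LL0 : L != L0 by apply: contraNneq zL0 => <-.
exists (ins L); first exact: insF.
rewrite !inE in yL; rewrite ranked_pleE !inE cL yL eqxx orbT /= leqNgt.
by have := zbelow L; rewrite !inE LL0 LF yL cL /=; apply.
Qed.

Lemma removal_local_realizer : local_realizer F'.
Proof.
case/and4P: realF => _ _ /forallP leF /forallP incF.
apply/and4P; split.
- by apply/set0Pn; exists lowx; exact: lowxF.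
- by apply/forall_inP=> N; exact: removal_ple.
- apply/forallP=> u; apply/forallP=> v; apply/implyP=> uv; apply/exists_inP.
  have [vx|vx] := eqVneq v x; last have [ux|ux] := eqVneq u x.
  + have [ux|ux] := eqVneq u x.
      exists lowx; first exact: lowxF.
      by rewrite ux vx ranked_pleE !inE eqxx leqnn.
    rewrite vx; apply: removal_below; apply: contra ux => xu.
    by rewrite eq_le xu -{1}vx uv.
  + rewrite ux; apply: removal_above; apply: contra vx => xv.
    by rewrite eq_le xv -{1}ux uv.
  + have /forallP/(_ (SubposetDel vx))/implyP/(_ uv) := leF (SubposetDel ux).
    by case/exists_inP=> L LF /(removal_keeps LF).
- apply/forallP=> u; apply/forallP=> v; apply/implyP=> uv; apply/exists_inP.
  have [vx|vx] := eqVneq v x; last have [ux|ux] := eqVneq u x.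
  + by rewrite vx; apply: removal_above; rewrite -vx incomparable_leF.
  + rewrite ux; apply: removal_below; rewrite -ux.
    by move: uv; rewrite negb_or => /andP[].
  + have /forallP/(_ (SubposetDel vx))/implyP/(_ uv) := incF (SubposetDel ux).
    by case/exists_inP=> L LF /(removal_keeps LF).
Qed.

(** * Counting occurrences *)

Lemma removal_mult z :
  (mult F' z <= (z \in low_ground) + ((z \in high_ground) +
                 #|[set L in F :\ L0 | z \in ins_ground L]|))%N.
Proof.
(* Only an upper bound holds in general: new members that coincide are counted once. *)
have mU N (G : {set {set T * T}}) :
  (mult (N |: G) z <= (z \in ple_ground N) + mult G z)%N.
  rewrite /mult -(cardsID [set N]) leq_add //.
    case: (boolP (z \in _)) => zN.
      by rewrite (leq_trans (subset_leq_card (subsetIr _ _))) ?cards1.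
    rewrite leqn0 cards_eq0; apply/eqP/setP=> M; rewrite !inE.
    by case: (M =P N) zN => [->|_ _]; rewrite ?inE ?andbF // => /negPf->.
  apply/subset_leq_card/subsetP=> M; rewrite !inE.
  by case: (M == N).
apply: leq_trans (mU _ _) _; rewrite ple_ground_ranked leq_add2l.
apply: leq_trans (mU _ _) _; rewrite ple_ground_ranked leq_add2l.
apply: leq_trans (leq_imset_card ins _).
apply/subset_leq_card/subsetP=> M; rewrite inE => /andP[/imsetP[L LF ->]].
by rewrite ple_ground_ranked => zL; apply: imset_f; rewrite inE LF.
Qed.

Lemma mult_setD1 c :
  mult F c = ((c \in ple_ground L0) +
              #|[set L in F :\ L0 | c \in ple_ground L]|)%N.
Proof.
rewrite /mult (cardsD1 L0) inE L0F; congr (_ + _)%N.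
by apply: eq_card => L; rewrite !inE andbA.
Qed.

Lemma removal_max_mult : (max_mult F' <= 1 + max_mult F)%N.
Proof.
apply/bigmax_leqP=> z _; apply: leq_trans (removal_mult z) _.
have [->|zx] := eqVneq z x.
  (* Of the two copies containing [x], one is paid for by the added 1 and the other by [L0], which
     contains [y]; elsewhere [x] occurs only where [y] does. *)
  apply: (@leq_trans (1 + mult F y)); last first.
    by rewrite leq_add2l (leq_bigmax (F := mult F)).
  rewrite mult_setD1 yL0 !inE eqxx /= !leq_add2l.
  apply/subset_leq_card/subsetP=> L.
  by rewrite !inE x_lift_ground eqxx andbT.
pose c : Q := SubposetDel zx.
apply: (@leq_trans (1 + mult F c)); last first.
  by rewrite leq_add2l (leq_bigmax (F := mult F)).
rewrite mult_setD1 addnA [(1 + _)%N]addnA leq_add //.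
  (* A point of [L0] lies in both copies, any other point in exactly one, as [belowx] decides. *)
  rewrite -mem_lift_ground !inE (negPf zx) /=.
  by case: (z \in _); case: (belowx z).
apply/subset_leq_card/subsetP=> L; rewrite [in X in _ -> X]inE.
by rewrite -mem_lift_ground !inE (negPf zx) andbF orbF.
Qed.

End Removal.

Theorem theorem3p2 (d : Order.disp_t) (T : finPOrderType d) (x : T)
    (hT : (2 <= #|T|)%N) :
  (ldim T <= 1 + ldim (subposet_del x))%N.
Proof.
have [z zx] : exists z, z != x.
  case: (pickP (predC1 x)) => [z zx|all_x]; first by exists z.
  by move: hT; rewrite (cardD1 x) (eq_card0 (A := [predD1 T & x])) // => z;
    have := all_x z; rewrite !inE andbT.
pose y : subposet_del x := SubposetDel zx.
rewrite [ldim (subposet_del x)]/ldim.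
case: ex_minnP => _ /existsP[F /andP[realF /eqP<-]] _.
(* Pairing [y] with itself shows that its star is non-empty. *)
have [L0 L0F /andP[yL0 _]] := star_cover y realF y.
rewrite /ldim; case: ex_minnP => m _ min_m.
apply: leq_trans (removal_max_mult L0F yL0); apply: min_m; apply/existsP.
exists (removal_realizer F y L0).
by rewrite removal_local_realizer ?eqxx.
Qed.
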